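(* For any graphs $G$ and $H$ with no isolated vertex, $$\gamma_{R}(G\times H)\leq \min\{\gamma(G)(n(H)+\gamma_{t}(H)),\ \gamma(H)(n(G)+\gamma_{t}(G))\}.$$
   Context: All graphs are finite and simple; $n(G)=|V(G)|$. The direct product $G\times H$ has vertex set $V(G)\times V(H)$, with $(u,v)$ adjacent to $(u',v')$ iff $uu'\in E(G)$ and $vv'\in E(H)$. $\gamma(G)$ is the domination number (minimum size of a set $S$ with every vertex in $S$ or adjacent to $S$); $\gamma_t(G)$ is the total domination number (minimum size of a set $D$ such that every vertex has a neighbor in $D$). A Roman dominating function on $G$ is $f:V(G)\to\{0,1,2\}$ such that every vertex with value $0$ has a neighbor with value $2$; $\gamma_R(G)$ is the minimum of $\sum_v f(v)$ over such $f$. *)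

(* Defs.v *)
From mathcomp Require Import all_boot.

Set Implicit Arguments.
Unset Strict Implicit.
Unset Printing Implicit Defensive.

Record sgraph := SGraph {
  vertex :> finType;
  adj : rel vertex;
  adj_sym : symmetric adj;
  adj_irrefl : irreflexive adj }.

Definition graph_order (G : sgraph) : nat := #|{: G}|.

Definition no_isolated (G : sgraph) : Prop :=
  forall v : G, exists u : G, adj v u.

Section DirectProduct.
Variables G H : sgraph.

Definition dprod_adj : rel (G * H)%type :=
  fun x y => adj x.1 y.1 && adj x.2 y.2.

Lemma dprod_adj_sym : symmetric dprod_adj.
Proof. by move=> x y; rewrite /dprod_adj adj_sym [adj x.2 _]adj_sym. Qed.

Lemma dprod_adj_irrefl : irreflexive dprod_adj.
Proof. by move=> x; rewrite /dprod_adj adj_irrefl. Qed.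

Definition direct_product : sgraph := SGraph dprod_adj_sym dprod_adj_irrefl.
End DirectProduct.

Section Invariants.
Variable G : sgraph.

Definition dominating (S : {set G}) : bool :=
  [forall v, (v \in S) || [exists u in S, adj v u]].

Definition total_dominating (D : {set G}) : bool :=
  [forall v, [exists u in D, adj v u]].

Definition roman_dominating (f : {ffun G -> 'I_3}) : bool :=
  [forall v, (f v == 0 :> nat) ==> [exists u, adj v u && (f u == 2 :> nat)]].

Definition roman_weight (f : {ffun G -> 'I_3}) : nat := \sum_v f v.

Definition domination_number : nat :=
  #|[arg min_(S < [set: G] | dominating S) #|S|]|.

(* If G has an isolated vertex there is no total dominating set, and the value
   is the conventional [graph_order G]. *)
Definition total_domination_number : nat :=
  #|[arg min_(D < [set: G] | total_dominating D) #|D|]|.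

(* The seed of the minimum is the constant function 2. *)
Definition roman_domination_number : nat :=
  roman_weight [arg min_(f < [ffun=> ord_max] | roman_dominating f)
                  roman_weight f].
End Invariants.

(* Main.v *)
Require Import Defs.
From mathcomp Require Import all_boot.

(** For S dominating G and D total dominating H, give the vertices of S x D the
    value 2, the other vertices of S x V(H) the value 1, and all others 0.  If
    g is not in S, then (g, h) is adjacent to (s, d) for any neighbours s in S
    of g and d in D of h.  The weight is |S| (n(H) + |D|); the other bound
    follows by swapping the factors. *)

Section Minimizers.
Variable G : sgraph.

Lemma roman_domination_number_le (f : {ffun G -> 'I_3}) :
  roman_dominating f -> roman_domination_number G <= roman_weight f.
Proof.
move=> fP; rewrite /roman_domination_number.
case: arg_minnP => [|g _ gmin]; last exact: gmin.
(* The seed takes the value 2 everywhere, so no vertex has value 0 and the condition is vacuous. *)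
by apply/forallP=> v; rewrite ffunE.
Qed.

Lemma roman_domination_number_witness :
  exists2 f : {ffun G -> 'I_3},
    roman_dominating f & roman_weight f = roman_domination_number G.
Proof.
rewrite /roman_domination_number.
case: arg_minnP => [|f fP _]; last by exists f.
by apply/forallP=> v; rewrite ffunE.
Qed.

Lemma domination_number_witness :
  exists2 S : {set G}, dominating S & #|S| = domination_number G.
Proof.
rewrite /domination_number.
case: arg_minnP => [|S SP _]; last by exists S.
by apply/forallP=> v; rewrite in_setT.
Qed.

(** Having no isolated vertex is exactly what makes the seed [[set: G]] totally dominating, so the
    minimum is attained by a genuine total dominating set instead of being the default value. *)
Lemma total_domination_number_witness :
  no_isolated G ->
  exists2 D : {set G}, total_dominating D & #|D| = total_domination_number G.
Proof.
move=> noiso; rewrite /total_domination_number.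
case: arg_minnP => [|D DP _]; last by exists D.
apply/forallP=> v; have [u vu] := noiso v.
by apply/existsP; exists u; rewrite in_setT.
Qed.

End Minimizers.

Section ProductBound.
Variables G H : sgraph.

(** The three values are written as one product, a factor depending on [x.1] times a factor
    depending on [x.2], so that the weight splits into a product of two sums. The product is at most
    2, so [inord] does not alter it. *)
Definition product_roman (S : {set G}) (D : {set H}) :
    {ffun direct_product G H -> 'I_3} :=
  [ffun x => inord ((x.1 \in S) * (x.2 \in D).+1)].

Lemma product_romanE S D x :
  product_roman S D x = (x.1 \in S) * (x.2 \in D).+1 :> nat.
Proof. by rewrite ffunE inordK //; case: (_ \in S); case: (_ \in D). Qed.

Lemma product_roman_dominating S D :
  dominating S -> total_dominating D -> roman_dominating (product_roman S D).
Proof.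
move=> /forallP domS /forallP domD; apply/forallP=> -[g h]; apply/implyP.
(* The second factor is a successor, so the value vanishes only when [g] lies outside [S]. *)
rewrite product_romanE muln_eq0 orbF eqb0 /= => gS.
have /existsP[s /andP[sS gs]] : [exists u in S, adj g u].
  by have := domS g; rewrite (negPf gS).
(* Adjacency in the product moves both coordinates, so [h] needs a neighbour in [D] even when [h]
   itself is in [D]; this is total domination. *)
have /existsP[d /andP[dD hd]] := domD h.
by apply/existsP; exists (s, d); rewrite product_romanE /dprod_adj /= sS dD gs hd.
Qed.

Lemma product_roman_weight S D :
  roman_weight (product_roman S D) = #|S| * (graph_order H + #|D|).
Proof.
rewrite /roman_weight (eq_bigr _ (fun x _ => product_romanE S D x)).
transitivity (\sum_(g : G) \sum_(h : H) (g \in S) * (h \in D).+1).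
  by rewrite pair_bigA.
have card_sum (T : finType) (A : {set T}) : #|A| = \sum_x (x \in A).
  by rewrite -sum1_card big_mkcond; apply: eq_bigr => x _; case: (x \in A).
rewrite (card_sum _ S) big_distrl /=; apply: eq_bigr => g _.
rewrite -big_distrr /=; congr (_ * _).
(* The summand 1 counts all of [H], and the indicator counts [D]. *)
rewrite (eq_bigr (fun h => 1 + (h \in D))) // big_split /=.
by rewrite sum1_card -card_sum.
Qed.

Lemma roman_direct_product_le :
  no_isolated H ->
  roman_domination_number (direct_product G H) <=
    domination_number G * (graph_order H + total_domination_number H).
Proof.
move=> noiso; have [S domS <-] := domination_number_witness G.
have [D domD <-] := total_domination_number_witness H noiso.
rewrite -product_roman_weight; apply: roman_domination_number_le.
exact: product_roman_dominating.
Qed.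

(** Exchanging coordinates is a graph isomorphism, so an optimal function on one product transports
    to the other with the same weight. *)
Lemma roman_direct_product_swap :
  roman_domination_number (direct_product G H) <=
    roman_domination_number (direct_product H G).
Proof.
have [f /forallP fP <-] := roman_domination_number_witness (direct_product H G).
pose f' : {ffun direct_product G H -> 'I_3} := [ffun x => f (x.2, x.1)].
have -> : roman_weight f = roman_weight f'.
  rewrite /roman_weight (reindex (fun x : G * H => (x.2, x.1))) /=.
    by apply: eq_bigr => x _; rewrite ffunE.
  by exists (fun x : H * G => (x.2, x.1)) => -[].
apply: roman_domination_number_le; apply/forallP=> -[g h].
rewrite ffunE; apply/implyP=> /(implyP (fP (h, g))).
case/existsP=> -[h' g'] /andP[/andP[/= hh' gg'] f2].
by apply/existsP; exists (g', h'); rewrite ffunE f2 /dprod_adj /= gg' hh'.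
Qed.

End ProductBound.

Theorem theorem2p8 (G H : sgraph)
    (hG : no_isolated G) (hH : no_isolated H) :
  roman_domination_number (direct_product G H) <=
    minn (domination_number G * (graph_order H + total_domination_number H))
         (domination_number H * (graph_order G + total_domination_number G)).
Proof.
rewrite leq_min roman_direct_product_le //=.
exact: leq_trans (roman_direct_product_swap G H) (roman_direct_product_le H G hG).
Qed.
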